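(* Let $G$ be a group, $N$ a normal subgroup of $G$, and $H_1,H_2\subseteq G$ subsets such that $N\subseteq H_i$ for $i=1,2$. Then the following hold: (1) $\varnothing\neq \underline{\operatorname{Apr}}_{G/N}(H_1/N)\subseteq H_1/N\subseteq \overline{\operatorname{Apr}}_{G/N}(H_1/N)$. (2) $\overline{\operatorname{Apr}}_{G/N}((H_1\cup H_2)/N)=\overline{\operatorname{Apr}}_{G/N}(H_1/N)\cup \overline{\operatorname{Apr}}_{G/N}(H_2/N)$. (3) $\underline{\operatorname{Apr}}_{G/N}(H_1/N)\cup \underline{\operatorname{Apr}}_{G/N}(H_2/N)\subseteq \underline{\operatorname{Apr}}_{G/N}((H_1\cup H_2)/N)$. (4) $\overline{\operatorname{Apr}}_{G/N}((H_1\cup H_2)/N)=\overline{\operatorname{Apr}}_{G/N}((H_1/N)\cup (H_2/N))$. (5) $\underline{\operatorname{Apr}}_{G/N}((H_1\cup H_2)/N)=\underline{\operatorname{Apr}}_{G/N}((H_1/N)\cup (H_2/N))$. (6) If $H_1\subseteq H_2$ then $\underline{\operatorname{Apr}}_{G/N}(H_1/N)\subseteq \underline{\operatorname{Apr}}_{G/N}(H_2/N)$. (7) If $H_1\subseteq H_2$ then $\overline{\operatorname{Apr}}_{G/N}(H_1/N)\subseteq \overline{\operatorname{Apr}}_{G/N}(H_2/N)$.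
   Context: Let $G$ be a group (written multiplicatively) and $N$ a normal subgroup of $G$. For a subset $H\subseteq G$ with $N\subseteq H$ (not necessarily a subgroup), $H/N:=\{hN : h\in H\}\subseteq G/N$. The relation $\theta$ on $G/N$ is conjugacy: $xN\,\theta\, yN$ iff $xN=(aya^{-1})N$ for some $a\in G$; the class of $xN$ is $[xN]_\theta=\{(axa^{-1})N : a\in G\}$. For a subset $S\subseteq G/N$, the lower and upper approximations are $\underline{\operatorname{Apr}}_{G/N}(S)=\{xN\in G/N : [xN]_\theta\subseteq S\}$ and $\overline{\operatorname{Apr}}_{G/N}(S)=\{xN\in G/N : [xN]_\theta\cap S\neq\varnothing\}$. *)

(* Defs.v *)
From mathcomp Require Import all_boot.
From mathcomp Require Import boolp classical_sets.

Set Implicit Arguments.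
Unset Strict Implicit.
Unset Printing Implicit Defensive.

Local Open Scope group_scope.
Local Open Scope classical_set_scope.

(* G is an arbitrary, possibly infinite, group. The finite-group notions of
   fingroup ({group gT}, <|, /) do not apply, so cosets are plain subsets of G
   and a subset of G/N is a set of cosets. *)

Definition normal_subgroup (G : groupType) (N : set G) : Prop :=
  group_closed (mem N) /\ forall x g : G, N x -> N (g * x * g^-1).

Definition left_coset (G : groupType) (N : set G) (x : G) : set G :=
  [set x * n | n in N].

(* H need not be a subgroup, nor a union of cosets of N. *)
Definition quotient_set (G : groupType) (H N : set G) : set (set G) :=
  [set left_coset N h | h in H].

Definition theta (G : groupType) (N : set G) (A B : set G) : Prop :=
  exists x y : G, [/\ A = left_coset N x, B = left_coset N y &
    exists a : G, left_coset N x = left_coset N (a * y * a^-1)].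

Definition theta_class (G : groupType) (N : set G) (A : set G) : set (set G) :=
  [set B | theta N B A].

Definition lower_apr (G : groupType) (N : set G) (S : set (set G)) :
    set (set G) :=
  [set A | quotient_set setT N A /\ theta_class N A `<=` S].

Definition upper_apr (G : groupType) (N : set G) (S : set (set G)) :
    set (set G) :=
  [set A | quotient_set setT N A /\ theta_class N A `&` S !=set0].

Lemma normal_subgroup1 (G : groupType) (N : set G) :
  normal_subgroup N -> N 1.
Proof. by case=> -[N1 _] _; exact: set_mem N1. Qed.

Lemma normal_subgroupF (G : groupType) (N : set G) (x y : G) :
  normal_subgroup N -> N x -> N y -> N (x * y^-1).
Proof.
by case=> -[_ NF] _ Nx Ny; apply: set_mem; apply: NF; exact: mem_set.
Qed.

Lemma normal_subgroupV (G : groupType) (N : set G) (x : G) :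
  normal_subgroup N -> N x -> N x^-1.
Proof.
move=> nN Nx; rewrite -[x^-1]mul1g.
by apply: normal_subgroupF => //; exact: normal_subgroup1.
Qed.

Lemma normal_subgroupM (G : groupType) (N : set G) (x y : G) :
  normal_subgroup N -> N x -> N y -> N (x * y).
Proof.
move=> nN Nx Ny; rewrite -[y]invgK.
by apply: normal_subgroupF => //; exact: normal_subgroupV.
Qed.

Lemma left_coset_eqP (G : groupType) (N : set G) (x y : G) :
  normal_subgroup N -> left_coset N x = left_coset N y <-> N (x^-1 * y).
Proof.
move=> nN; split=> [eqxy|Nxy].
  have : left_coset N y y by exists 1; [exact: normal_subgroup1|exact: mulg1].
  by rewrite -eqxy => -[n Nn <-]; rewrite mulKg.
apply/seteqP; split=> _ [n Nn <-].
  exists ((x^-1 * y)^-1 * n); last by rewrite invgM invgK !mulgA mulgV mul1g.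
  by apply: normal_subgroupM => //; exact: normal_subgroupV.
exists (x^-1 * y * n); last by rewrite !mulgA mulgV mul1g.
exact: normal_subgroupM.
Qed.

(* theta_class does not depend on the representative of the coset. *)
Lemma theta_classE (G : groupType) (N : set G) (x : G) :
  normal_subgroup N ->
  theta_class N (left_coset N x) = [set left_coset N (a * x * a^-1) | a in setT].
Proof.
move=> nN; apply/seteqP; split=> [_ [z [y [-> exy [a ->]]]]|_ [a _ <-]].
  exists a => //; apply/left_coset_eqP => //.
  have /(left_coset_eqP _ _ nN) Nxy := exy.
  have -> : (a * x * a^-1)^-1 * (a * y * a^-1) = a * (x^-1 * y) * a^-1.
    by rewrite !invgM invgK -!mulgA mulKg.
  by case: nN => _; apply.
by exists (a * x * a^-1), x; split=> //; exists a.
Qed.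

(* Main.v *)
Require Import Defs.
From mathcomp Require Import all_boot.
From mathcomp Require Import boolp classical_sets.

(** Call a conjugacy class of cosets a block. The lower approximation of [S]
    collects the cosets whose block lies inside [S], the upper approximation
    those whose block meets [S].  Both are therefore monotone in [S]
    ([lower_aprS], [upper_aprS]), and since a block meets a union exactly when
    it meets one of its members, the upper approximation commutes with unions
    ([upper_aprU]).  As every coset lies in its own block
    ([theta_class_refl]), a set [S] of cosets is caught between its
    two approximations.

    All this is transported to subsets of the group because [H |-> H/N] is a
    direct image, hence monotone and compatible with unions.  Finally, the
    lower approximation is nonempty because the block of the trivial coset [N]
    is reduced to [N], the identity being conjugate to itself only, and [N]
    belongs to [H/N] as soon as [H] contains the identity
    ([lower_apr_coset1]). *)

Local Open Scope group_scope.
Local Open Scope classical_set_scope.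

(** The conjugating element is the identity. *)
Lemma theta_class_refl (G : groupType) (N A : set G) :
  quotient_set setT N A -> theta_class N A A.
Proof.
by case=> x _ <-; exists x, x; split=> //; exists 1; rewrite mul1g invg1 mulg1.
Qed.

Lemma quotient_setS (G : groupType) (H K N : set G) :
  H `<=` K -> quotient_set H N `<=` quotient_set K N.
Proof. exact: image_subset. Qed.

Lemma quotient_setU (G : groupType) (H K N : set G) :
  quotient_set (H `|` K) N = quotient_set H N `|` quotient_set K N.
Proof. exact: image_setU. Qed.

Lemma lower_aprS (G : groupType) (N : set G) (S T : set (set G)) :
  S `<=` T -> lower_apr N S `<=` lower_apr N T.
Proof. by move=> sST A [GA sAS]; split=> //; exact: subset_trans sAS sST. Qed.

Lemma upper_aprS (G : groupType) (N : set G) (S T : set (set G)) :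
  S `<=` T -> upper_apr N S `<=` upper_apr N T.
Proof.
by move=> sST A [GA [B [AB SB]]]; split=> //; exists B; split=> //; exact: sST.
Qed.

Lemma upper_aprU (G : groupType) (N : set G) (S T : set (set G)) :
  upper_apr N (S `|` T) = upper_apr N S `|` upper_apr N T.
Proof.
apply/seteqP; split=> [A [GA [B [AB [SB|TB]]]]|].
- by left; split=> //; exists B.
- by right; split=> //; exists B.
by rewrite subUset; split; apply: upper_aprS => A SA; [left|right].
Qed.

Lemma lower_apr_sub (G : groupType) (N : set G) (S : set (set G)) :
  lower_apr N S `<=` S.
Proof. by move=> A [GA]; apply; exact: theta_class_refl. Qed.

(** The hypothesis is forced: an approximation contains only cosets. *)
Lemma sub_upper_apr (G : groupType) (N : set G) (S : set (set G)) :
  S `<=` quotient_set setT N -> S `<=` upper_apr N S.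
Proof.
move=> sSG A SA; have GA := sSG A SA.
by split=> //; exists A; split=> //; exact: theta_class_refl.
Qed.

(** The class of the trivial coset is a singleton, since [a * 1 * a^-1 = 1];
    normality of [N] ensures that the class can be computed from the
    representative [1]. *)
Lemma lower_apr_coset1 (G : groupType) (N : set G) (S : set (set G)) :
  normal_subgroup N -> S (left_coset N 1) -> lower_apr N S (left_coset N 1).
Proof.
move=> nN S1; split; first by exists 1.
by rewrite theta_classE // => _ [a _ <-]; rewrite mulg1 mulgV.
Qed.

Local Close Scope group_scope.

Theorem proposition2p6 (G : groupType) (N H1 H2 : set G)
    (nN : normal_subgroup N) (sNH1 : N `<=` H1) (sNH2 : N `<=` H2) :
  (lower_apr N (quotient_set H1 N) !=set0 /\
   lower_apr N (quotient_set H1 N) `<=` quotient_set H1 N /\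
   quotient_set H1 N `<=` upper_apr N (quotient_set H1 N)) /\
  upper_apr N (quotient_set (H1 `|` H2) N) =
    upper_apr N (quotient_set H1 N) `|` upper_apr N (quotient_set H2 N) /\
  lower_apr N (quotient_set H1 N) `|` lower_apr N (quotient_set H2 N) `<=`
    lower_apr N (quotient_set (H1 `|` H2) N) /\
  upper_apr N (quotient_set (H1 `|` H2) N) =
    upper_apr N (quotient_set H1 N `|` quotient_set H2 N) /\
  lower_apr N (quotient_set (H1 `|` H2) N) =
    lower_apr N (quotient_set H1 N `|` quotient_set H2 N) /\
  (H1 `<=` H2 ->
    lower_apr N (quotient_set H1 N) `<=` lower_apr N (quotient_set H2 N)) /\
  (H1 `<=` H2 ->
    upper_apr N (quotient_set H1 N) `<=` upper_apr N (quotient_set H2 N)).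
Proof.
rewrite quotient_setU; split; [split; [|split]|split; [|split; [|split; [|split; [|split]]]]].
- exists (left_coset N 1%g); apply: lower_apr_coset1 => //.
  by exists 1%g => //; apply: sNH1; exact: normal_subgroup1.
- exact: lower_apr_sub.
- by apply: sub_upper_apr; exact: quotient_setS.
- exact: upper_aprU.
- by rewrite subUset; split; apply: lower_aprS => A SA; [left|right].
- by [].
- by [].
- by move=> sH12; apply: lower_aprS; exact: quotient_setS.
- by move=> sH12; apply: upper_aprS; exact: quotient_setS.
Qed.
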